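(* Let $r\ge 2$, $n\ge 1$ and $0\le k\le n$ be integers. The graded vector spaces $R_{n,k}$ and $S_{n,k}$ have the following Hilbert series: $$\mathrm{Hilb}(R_{n,k};q)=\sum_{z=0}^{n}\binom{n}{z}q^{krz}\cdot \mathrm{rev}_q\bigl([r]_q^{n-z}\cdot[k]!_{q^r}\cdot\mathrm{Stir}_{q^r}(n-z,k)\bigr)=\sum_{z=0}^{n}\binom{n}{z}q^{krz}\cdot[r]_q^{n-z}\cdot[k]!_{q^r}\cdot\mathrm{rev}_q\bigl(\mathrm{Stir}_{q^r}(n-z,k)\bigr),$$ $$\mathrm{Hilb}(S_{n,k};q)=\mathrm{rev}_q\bigl([r]_q^{n}\cdot[k]!_{q^r}\cdot\mathrm{Stir}_{q^r}(n,k)\bigr)=[r]_q^{n}\cdot[k]!_{q^r}\cdot\mathrm{rev}_q\bigl(\mathrm{Stir}_{q^r}(n,k)\bigr).$$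
   Context: Let $e_d(\mathbf{x}_n^r)=e_d(x_1^r,\dots,x_n^r)$ be the $d$-th elementary symmetric polynomial in $x_1^r,\dots,x_n^r$. Define the homogeneous ideals $$I_{n,k}=\langle x_1^{kr+1},\dots,x_n^{kr+1},e_n(\mathbf{x}_n^r),e_{n-1}(\mathbf{x}_n^r),\dots,e_{n-k+1}(\mathbf{x}_n^r)\rangle,$$ $$J_{n,k}=\langle x_1^{kr},\dots,x_n^{kr},e_n(\mathbf{x}_n^r),e_{n-1}(\mathbf{x}_n^r),\dots,e_{n-k+1}(\mathbf{x}_n^r)\rangle$$ of $\mathbb{C}[x_1,\dots,x_n]$, and $R_{n,k}=\mathbb{C}[x_1,\dots,x_n]/I_{n,k}$, $S_{n,k}=\mathbb{C}[x_1,\dots,x_n]/J_{n,k}$. For a graded vector space $V=\bigoplus_d V_d$, $\mathrm{Hilb}(V;q)=\sum_d\dim(V_d)q^d$. $[m]_q=1+q+\cdots+q^{m-1}$, $[m]!_q=[m]_q[m-1]_q\cdots[1]_q$ (with $[0]!_q=1$). The $q$-Stirling numbers are defined by $\mathrm{Stir}_q(m,k)=[k]_q\cdot\mathrm{Stir}_q(m-1,k)+\mathrm{Stir}_q(m-1,k-1)$ for $m,k\ge1$, with $\mathrm{Stir}_q(0,k)=\delta_{0,k}$ and $\mathrm{Stir}_q(m,0)=0$ for $m\ge1$. A subscript $q^r$ means that $q$ is replaced by $q^r$. The operator $\mathrm{rev}_q$ reverses the coefficient sequence of a polynomial in $q$: $\mathrm{rev}_q(f)(q)=q^{\deg f}f(1/q)$,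 with $\mathrm{rev}_q(0)=0$. *)

(* Defs.v *)
From HB Require Import structures.
From mathcomp Require Import all_boot all_order all_algebra.
From mathcomp Require Import boolp classical_sets reals.
From mathcomp Require Import complex mpoly.

Set Implicit Arguments.
Unset Strict Implicit.
Unset Printing Implicit Defensive.

Import GRing.Theory.

Local Open Scope ring_scope.
Local Open Scope quotient_scope.
Local Open Scope classical_set_scope.

Section Ideal.
Variables (F : fieldType) (n : nat).
Implicit Types (s : seq {mpoly F[n]}) (p : {mpoly F[n]}).

Definition ideal_gen s : pred {mpoly F[n]} := fun p =>
  `[< exists c : 'I_(size s) -> {mpoly F[n]}, p = \sum_i c i * s`_i >].

Lemma ideal_genM s p q : p \in ideal_gen s -> q * p \in ideal_gen s.
Proof.
move=> /asboolP[c ->]; apply/asboolP; exists (fun i => q * c i).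
by rewrite mulr_sumr; apply: eq_bigr => i _; rewrite mulrA.
Qed.

Lemma ideal_gen_zmod s : zmod_closed (ideal_gen s).
Proof.
split.
  apply/asboolP; exists (fun=> 0); rewrite big1// => i _.
  by rewrite mul0r.
move=> p q /asboolP[c ->] /asboolP[d ->]; apply/asboolP.
exists (fun i => c i - d i); rewrite -sumrB.
by apply: eq_bigr => i _; rewrite mulrBl.
Qed.

HB.instance Definition _ s :=
  GRing.isZmodClosed.Build {mpoly F[n]} (ideal_gen s) (ideal_gen_zmod s).

Definition ideal_of s : zmodClosed {mpoly F[n]} :=
  GRing.ZmodClosed.clone _ (ideal_gen s) _.

(* The library puts a ring structure on [{ideal_quot I}] only for a proper   *)
(* ideal I, while the ideals below can be the unit ideal.  The additive      *)
(* quotient exists for every I; it is made into an F-vector space here.      *)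
Definition mquot s : Type := {ideal_quot (ideal_of s)}.

HB.instance Definition _ s := Choice.on (mquot s).
HB.instance Definition _ s := GRing.Zmodule.on (mquot s).

Definition mquot_pi s p : mquot s := \pi_({ideal_quot (ideal_of s)}) p.

Definition mquot_scale s (a : F) (u : mquot s) : mquot s :=
  mquot_pi s (a *: repr (u : {ideal_quot (ideal_of s)})).

Lemma mquot_piP s p q :
  mquot_pi s p = mquot_pi s q <-> p - q \in ideal_gen s.
Proof.
rewrite /mquot_pi Quotient.idealrBE; split=> [->//|/eqP//].
Qed.

Lemma mquot_piD s p q : mquot_pi s (p + q) = mquot_pi s p + mquot_pi s q.
Proof. exact: Quotient.pi_add. Qed.

Lemma mquot_piK s u : mquot_pi s (repr (u : {ideal_quot (ideal_of s)})) = u.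
Proof. exact: reprK. Qed.

Lemma mquot_scaleE s a p :
  mquot_scale a (mquot_pi s p) = mquot_pi s (a *: p).
Proof.
apply/mquot_piP; rewrite -scalerBr -mul_mpolyC; apply: ideal_genM.
by apply/mquot_piP; rewrite mquot_piK.
Qed.

Lemma mquot_scaleA s a b (u : mquot s) :
  mquot_scale a (mquot_scale b u) = mquot_scale (a * b) u.
Proof. by rewrite -(mquot_piK u) !mquot_scaleE scalerA. Qed.

Lemma mquot_scale1 s : left_id 1 (@mquot_scale s).
Proof. by move=> u; rewrite -(mquot_piK u) mquot_scaleE scale1r. Qed.

Lemma mquot_scaleDr s : right_distributive (@mquot_scale s) +%R.
Proof.
move=> a u v; rewrite -(mquot_piK u) -(mquot_piK v).
by rewrite -mquot_piD !mquot_scaleE scalerDr mquot_piD.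
Qed.

Lemma mquot_scaleDl s (u : mquot s) :
  {morph (@mquot_scale s)^~ u : a b / a + b}.
Proof.
by move=> a b; rewrite -(mquot_piK u) !mquot_scaleE scalerDl mquot_piD.
Qed.

HB.instance Definition _ s := GRing.Zmodule_isLmodule.Build F (mquot s)
  (@mquot_scaleA s) (@mquot_scale1 s) (@mquot_scaleDr s) (@mquot_scaleDl s).

Definition mquot_deg s (d : nat) : set (mquot s) :=
  [set mquot_pi s p | p in [set p | p \is d.-homog]].

End Ideal.

Section Hilbert.
Variables (F : fieldType) (V : lmodType F).

Definition has_dim (W : set V) (m : nat) : Prop :=
  exists b : 'I_m -> V,
    [/\ forall i, W (b i),
        forall c : 'I_m -> F, \sum_i c i *: b i = 0 -> forall i, c i = 0
      & forall v, W v -> exists c : 'I_m -> F, v = \sum_i c i *: b i].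

Definition Hilb_is (W : nat -> set V) (P : {poly int}) : Prop :=
  forall d, exists2 m : nat, has_dim (W d) m & P`_d = m%:Z.

End Hilbert.

Section Ideals.
Variables (F : fieldType) (r n k : nat).

Definition e_pow (d : nat) : {mpoly F[n]} :=
  mesym n F d \mPo [tuple 'X_i ^+ r | i < n].

Definition gens_I : seq {mpoly F[n]} :=
  [seq 'X_i ^+ (k * r + 1) | i : 'I_n] ++ [seq e_pow (n - j) | j <- iota 0 k].

Definition gens_J : seq {mpoly F[n]} :=
  [seq 'X_i ^+ (k * r) | i : 'I_n] ++ [seq e_pow (n - j) | j <- iota 0 k].

Definition Rnk := mquot gens_I.
Definition Snk := mquot gens_J.

HB.instance Definition _ := GRing.Lmodule.on Rnk.
HB.instance Definition _ := GRing.Lmodule.on Snk.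

Definition Rnk_deg (d : nat) : set Rnk := @mquot_deg F n gens_I d.
Definition Snk_deg (d : nat) : set Snk := @mquot_deg F n gens_J d.

End Ideals.

Arguments Rnk_deg : clear implicits.
Arguments Snk_deg : clear implicits.

Definition q_int (m : nat) : {poly int} := \sum_(i < m) 'X^i.

Definition q_fact (m : nat) : {poly int} := \prod_(i < m) q_int i.+1.

Fixpoint q_stir (m k : nat) : {poly int} :=
  match m, k with
  | 0, 0 => 1
  | 0, _.+1 => 0
  | _.+1, 0 => 0
  | m'.+1, k'.+1 => q_int k * q_stir m' k + q_stir m' k'
  end.

(* f(q^r) *)
Definition q_pow (r : nat) (f : {poly int}) : {poly int} := f \Po 'X^r.

(* The coefficient list of a polynomial has no trailing zeros, so this is    *)
(* q^(deg f) f(1/q); in particular it maps 0 to 0.                           *)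
Definition rev_q (f : {poly int}) : {poly int} := Poly (rev f).

(* Main.v *)
Require Import Defs.
From HB Require Import structures.
From mathcomp Require Import all_boot all_order all_algebra.
From mathcomp Require Import boolp classical_sets reals.
From mathcomp Require Import complex mpoly.
From mathcomp Require Import separable cyclotomic.
From mathcomp Require Import zify ring.

Set Implicit Arguments.
Unset Strict Implicit.
Unset Printing Implicit Defensive.

Import GRing.Theory Num.Theory.

Local Open Scope ring_scope.

(** Both ideals are generated by the [c]-th powers of the variables, with
    [c = k r] or [c = k r + 1], and by the [k] lowest coefficients of
    [\prod_i (T + x_i ^ r)].  The proof exhibits a basis of standard monomials for
    both quotients at once.

    Upper bound ([straightening]).  A recursion on the variables yields a set of
    monomials [B(n, s)], for the ideal with [s] coefficients instead of [k], that
    spans the quotient: the exponent [t] of the first variable is less than [c],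
    and the rest of the monomial is in [B(n-1, s-1)] if [t < r s] and in
    [B(n-1, s)] if [r s <= t].

    Lower bound (orbit harmonics).  Fix [k] distinct nonzero numbers and let [X]
    consist of their [r]-th roots, together with 0 when [c = k r + 1]; thus [X]
    has [c] elements.  Let [Y] be the set of the words of length [n] over [X]
    whose [r]-th powers include all [k] numbers.  Each generator of the ideal is
    the leading form of a polynomial that vanishes on [Y] ([in_gr_power],
    [in_gr_esym_poly]), so the ideal is contained in the associated graded ideal
    of the vanishing ideal of [Y].  A set of monomials that spans modulo the
    latter has at least [#|Y|] elements ([leq_spanning]).  Reading a word from the
    left shows that [#|Y|] satisfies the same recursion as the size of [B(n, k)]
    ([size_words]), so the standard monomials are linearly independent.

    Hilbert series.  The recursion for [B(n, s)] becomes
    [G(n, s) = [r s]_q G(n-1, s-1) + q ^ (r s) [c - r s]_q G(n-1, s)] for the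
    generating function by degree ([word_hilb]).  For [c = k r] the
    [r]-dependence splits off as [[r]_q ^ n] and the substitution of [q ^ r]
    ([word_hilb_q_pow]), and for [r = 1] the value at [s = k] is [[k]!_q] times
    the reversed q-Stirling number ([word_hilb_rev_stir]).  The case
    [c = k r + 1] is a binomial transform of the case [c = k r]
    ([word_hilb_zero_letter]).  The equalities between the two forms of the
    series hold as reversal is multiplicative and the q-integers are palindromic. *)

(** * Subspaces and straightening *)

Definition subspace (F : fieldType) (V : lmodType F) (N : V -> Prop) : Prop :=
  N 0 /\ forall a p q, N p -> N q -> N (a *: p + q).

Section Subspace.
Variables (F : fieldType) (V : lmodType F) (N : V -> Prop).
Hypothesis linN : subspace N.

Lemma subspaceD p q : N p -> N q -> N (p + q).
Proof. by move=> Np Nq; rewrite -[p]scale1r; apply: linN.2. Qed.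

Lemma subspaceZ a p : N p -> N (a *: p).
Proof. by move=> Np; rewrite -[_ *: _]addr0; apply: linN.2 => //; case: linN. Qed.

Lemma subspaceB p q : N p -> N q -> N (p - q).
Proof. by move=> Np Nq; rewrite addrC -scaleN1r; apply: linN.2. Qed.

Lemma subspace_sum (I : Type) (s : seq I) (P : pred I) (f : I -> V) :
  (forall i, P i -> N (f i)) -> N (\sum_(i <- s | P i) f i).
Proof. by move=> Nf; apply: big_ind => //; [case: linN | exact: subspaceD]. Qed.

End Subspace.

Section Straightening.
Variables (F : fieldType) (n r c : nat).
Implicit Types (vs : seq 'I_n) (mu : 'X_{1..n}) (p q u : {mpoly F[n]}).

Definition supported vs mu : Prop := forall i, i \notin vs -> mu i = 0%N.

(** The largest part of [N] that is stable under multiplication by the variables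
    of [vs].  A typical [N] is the sum of an ideal and of the span of some
    monomials, which is not stable; hence [straightening] takes the relations in
    the core of [N] rather than in [N]. *)
Definition core vs (N : {mpoly F[n]} -> Prop) p : Prop :=
  forall mu, supported vs mu -> N ('X_[mu] * p).

Lemma supported_cons v vs mu : supported vs mu -> supported (v :: vs) mu.
Proof. by move=> Smu i; rewrite inE negb_or => /andP[_]; apply: Smu. Qed.

Lemma supportedD vs mu nu :
  supported vs mu -> supported vs nu -> supported vs (mu + nu)%MM.
Proof. by move=> Smu Snu i vi; rewrite mnmDE Smu ?Snu. Qed.

Lemma supportedX v vs t : supported (v :: vs) (U_(v) *+ t)%MM.
Proof.
by move=> i; rewrite inE negb_or eq_sym mulmnE mnm1E => /andP[/negbTE-> _].
Qed.

Lemma core_subspace vs N : subspace N -> subspace (core vs N).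
Proof.
move=> [N0 NP]; split=> [mu _|a p q Np Nq mu Smu]; first by rewrite mulr0.
by rewrite mulrDr -scalerAr; apply: NP; [apply: Np | apply: Nq].
Qed.

Lemma core_cons v vs N p : core (v :: vs) N p -> core vs N p.
Proof. by move=> Np mu Smu; apply/Np/supported_cons. Qed.

Lemma core_mulX vs N mu p :
  supported vs mu -> core vs N p -> core vs N ('X_[mu] * p).
Proof.
by move=> Smu Np nu Snu; rewrite mulrA -mpolyXD; apply/Np/supportedD.
Qed.

(** The coefficients of [\prod_i (T + x_i ^ r)], read from the bottom, are
    [e_n, e_(n-1), ...] in the powers [x_i ^ r].  The symmetric generators of the
    ideals are thus its [k] lowest coefficients, in an indexing that does not
    shift when the number of variables changes. *)
Definition esym_poly vs : {poly {mpoly F[n]}} :=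
  \prod_(i <- vs) ('X + ('X_i ^+ r)%:P).

Lemma coef_esym_poly_cons v vs j :
  (esym_poly (v :: vs))`_j
    = (if j is i.+1 then (esym_poly vs)`_i else 0) + 'X_v ^+ r * (esym_poly vs)`_j.
Proof.
by rewrite /esym_poly big_cons mulrDl coefD coefCM coefXM; case: j.
Qed.

(** An exponent of the first variable below [r * s] lowers by one the number of
    coefficients of [\prod_i (T + x_i ^ r)] that remain available for the other
    variables; a larger exponent, up to [c], keeps all [s] of them. *)
Fixpoint std_mnm vs (s : nat) : seq 'X_{1..n} :=
  if vs is v :: vs' then
    [seq (U_(v) *+ t + b)%MM | t <- iota 0 (r * s), b <- std_mnm vs' s.-1] ++
    [seq (U_(v) *+ t + b)%MM | t <- iota (r * s) (c - r * s), b <- std_mnm vs' s]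
  else if s is 0 then [:: 0%MM] else [::].

Lemma core_mul_esym_poly vs vs' N j p : subspace N -> {subset vs' <= vs} ->
  core vs N p -> core vs N ((esym_poly vs')`_j * p).
Proof.
move=> linN; have linC := core_subspace vs linN.
elim: vs' j p => [|v vs' IH] j p sub_vs Np.
  rewrite /esym_poly big_nil coef1; case: eqP => _; first by rewrite mul1r.
  by rewrite mul0r; case: linC.
have {}IH i q : core vs N q -> core vs N ((esym_poly vs')`_i * q).
  by apply: IH => w vs_w; apply: sub_vs; rewrite inE vs_w orbT.
rewrite coef_esym_poly_cons mulrDl -mulrA mpolyXn; apply: (subspaceD linC).
  by case: j => [|j]; [rewrite mul0r; case: linC | apply: IH].
apply: core_mulX; last exact: IH.
move=> i vs_i; rewrite mulmnE mnm1E; case: eqP => // vi.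
by case/negP: vs_i; rewrite -vi; apply: sub_vs; rewrite mem_head.
Qed.

(** Write [y = x_v ^ r], [P] for the polynomial of [v :: vs] and [P'] for that of
    [vs], so that [P = (T + y) P'].  From [y P'_0 = P_0] and
    [y ^ (j+2) P'_(j+1) = y ^ (j+1) (P_(j+1) - P'_j)], multiplying by [y ^ (j+1)]
    brings the [j]-th coefficient of [P'] into the core. *)
Lemma core_esym_poly_tail v vs s u N : subspace N ->
    (forall j, (j < s)%N -> core (v :: vs) N (u * (esym_poly (v :: vs))`_j)) ->
  forall j, (j < s)%N ->
    core (v :: vs) N (u * ('X_v ^+ (r * j.+1) * (esym_poly vs)`_j)).
Proof.
move=> linN Nu; have linC := core_subspace (v :: vs) linN.
have shift t p : core (v :: vs) N (u * p) -> core (v :: vs) N (u * ('X_v ^+ t * p)).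
  move=> Np; rewrite mulrCA mpolyXn; apply: core_mulX => //; exact: supportedX.
elim=> [|j IHj] lt_js.
  by have := Nu 0%N lt_js; rewrite coef_esym_poly_cons add0r muln1.
have /IHj Nj : (j < s)%N by apply: ltn_trans lt_js.
have -> : 'X_v ^+ (r * j.+2) * (esym_poly vs)`_j.+1 = 'X_v ^+ (r * j.+1)
    * ((esym_poly (v :: vs))`_j.+1 - (esym_poly vs)`_j).
  by rewrite coef_esym_poly_cons addrC addKr mulrA -exprD mulnS addnC.
rewrite !mulrBr; apply: (subspaceB linC) => //; exact/shift/Nu.
Qed.

(** Peel off the first variable [v] and descend on its exponent [t], which is
    bounded since [u * x_v ^ c] is already in the core.  What remains to be shown
    is that [u * x_v ^ t] times a monomial in [vs] lies in [N], and the induction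
    hypothesis applies to [u * x_v ^ t] and [vs] because
    - when [r * s <= t], all [s] lowest coefficients of the polynomial of [vs] are
      available by [core_esym_poly_tail];
    - when [t < r * s], the relation [P'_j = P_(j+1) - x_v ^ r P'_(j+1)] provides
      [s - 1] of them, modulo multiples of [u * x_v ^ (t+1)], which have been
      treated before.
    The definition of [std_mnm] records these two cases. *)
Lemma straightening vs s u N : (r * s <= c)%N -> subspace N ->
    (forall i, i \in vs -> core vs N (u * 'X_i ^+ c)) ->
    (forall j, (j < s)%N -> core vs N (u * (esym_poly vs)`_j)) ->
    (forall b, b \in std_mnm vs s -> N (u * 'X_[b])) ->
  core vs N u.
Proof.
elim: vs s u N => [|v vs IH] s u N le_c linN Nc Nr Nb.
  case: s {le_c Nc} Nr Nb => [|s] Nr Nb.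
    move=> mu Smu; have -> : mu = 0%MM by apply/mnmP=> i; rewrite mnm0E Smu.
    by rewrite mulrC; apply: Nb; rewrite inE.
  by have := Nr 0%N isT; rewrite /esym_poly big_nil coef1 mulr1.
have linC := core_subspace (v :: vs) linN.
suff: forall t, core (v :: vs) N (u * 'X_v ^+ t) by move=> /(_ 0%N); rewrite mulr1.
have high t : (c <= t)%N -> core (v :: vs) N (u * 'X_v ^+ t).
  move=> le_ct; rewrite -(subnK le_ct) exprD mulrCA mpolyXn.
  by apply: core_mulX; [exact: supportedX | apply: Nc; rewrite mem_head].
move=> t; have [m le_m] := ubnP (c - t)%N; elim: m t le_m => // m IHm t le_m.
have [le_ct|lt_tc] := leqP c t; first exact: high.
have {}IHm : core (v :: vs) N (u * 'X_v ^+ t.+1) by apply: IHm; lia.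
suff low : core vs N (u * 'X_v ^+ t).
  move=> mu Smu; have [mu0|mu_gt0] := posnP (mu v).
    apply: low => i vi; have [->//|ne_iv] := eqVneq i v.
    by apply: Smu; rewrite inE negb_or ne_iv.
  have le_mu : (U_(v) <= mu)%MM.
    by apply/mnm_lepP => i; rewrite mnm1E; case: eqP => // <-.
  rewrite -(submK le_mu) mpolyXD -mulrA.
  rewrite (_ : 'X_v * _ = u * 'X_v ^+ t.+1); last by rewrite exprS; ring.
  apply: IHm => i vi; have := Smu i vi.
  by rewrite mnmBE => ->.
have shift i : i \in vs -> core (v :: vs) N (u * 'X_v ^+ t * 'X_i ^+ c).
  move=> vs_i; rewrite mulrAC mulrC mpolyXn; apply: core_mulX; first exact: supportedX.
  by apply: Nc; rewrite inE vs_i orbT.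
have [le_rs|lt_rs] := leqP (r * s) t.
  apply: (IH s) => // [i vs_i|j lt_js|b Bb].
  - exact: (core_cons (shift i vs_i)).
  - have := core_esym_poly_tail linN Nr lt_js.
    have le_j : (r * j.+1 <= t)%N by apply: leq_trans le_rs; rewrite leq_mul2l lt_js orbT.
    rewrite -(subnK le_j) exprD => /(core_mulX (@supportedX v vs (t - r * j.+1))).
    move/core_cons; congr (core vs N _); rewrite -mpolyXn; ring.
  - rewrite -mulrA mpolyXn -mpolyXD; apply: Nb => /=; rewrite mem_cat; apply/orP; right.
    apply/allpairsP; exists (t, b); split=> //=; rewrite mem_iota; lia.
case: s le_c Nr Nb lt_rs => [|s] le_c Nr Nb lt_rs; first by rewrite muln0 in lt_rs.
have Nroot j : (j < s)%N -> core (v :: vs) N (u * 'X_v ^+ t * (esym_poly vs)`_j).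
  move=> lt_js; rewrite (_ : _ * _ = 'X_[U_(v) *+ t] * (u * (esym_poly (v :: vs))`_j.+1)
    - ((esym_poly vs)`_j.+1 * 'X_v ^+ r.-1) * (u * 'X_v ^+ t.+1)); last first.
    rewrite coef_esym_poly_cons -mpolyXn.
    have r_gt0 : (0 < r)%N by case: (r) lt_rs.
    by rewrite -{1}(prednK r_gt0) !exprS; ring.
  apply: (subspaceB linC).
    by apply: core_mulX; [exact: supportedX | exact: Nr].
  rewrite -mulrA; apply: core_mul_esym_poly => //.
    by move=> i vs_i; rewrite inE vs_i orbT.
  by rewrite mpolyXn; apply: core_mulX; first exact: supportedX.
apply: (IH s) => // [|i vs_i|j lt_js|b Bb].
- by apply: leq_trans le_c; rewrite leq_mul2l leqnSn orbT.
- exact: (core_cons (shift i vs_i)).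
- exact: (core_cons (Nroot j lt_js)).
rewrite -mulrA mpolyXn -mpolyXD; apply: Nb => /=; rewrite mem_cat; apply/orP; left.
by apply/allpairsP; exists (t, b); split=> //=; rewrite mem_iota.
Qed.

End Straightening.

(** * Orbit harmonics *)

Lemma mpoly_subspace (F : fieldType) (n : nat) (N : {mpoly F[n]} -> Prop) p :
  subspace N -> (forall m, N 'X_[m]) -> N p.
Proof.
move=> linN NX; rewrite (mpolyE p); apply: subspace_sum => // m _.
exact: subspaceZ.
Qed.

Lemma pihomog_linear (F : fieldType) (n d : nat) a (p q : {mpoly F[n]}) :
  pihomog mdeg d (a *: p + q) = a *: pihomog mdeg d p + pihomog mdeg d q.
Proof. exact: linearP. Qed.

Lemma pihomog_mulX (F : fieldType) (n : nat) (i : 'I_n) d (p : {mpoly F[n]}) :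
  pihomog mdeg d ('X_i * p)
    = if d is e.+1 then 'X_i * pihomog mdeg e p else 0.
Proof.
apply: (mpoly_subspace (N := fun p => pihomog mdeg d ('X_i * p)
    = if d is e.+1 then 'X_i * pihomog mdeg e p else 0)) => [|mu].
  split=> [|a u v Nu Nv]; first by case: d => *; rewrite ?pihomog0 mulr0 ?pihomog0.
  rewrite mulrDr -scalerAr pihomog_linear Nu Nv; case: d {Nu Nv} => [|d].
    by rewrite scaler0 addr0.
  by rewrite pihomog_linear mulrDr -scalerAr.
rewrite -mpolyXD pihomogX /= mdegD mdeg1; case: d => [|d] //=.
by rewrite pihomogX /= add1n eqSS; case: ifP; rewrite ?mpolyXD ?mulr0.
Qed.

Section OrbitHarmonics.
Variables (F : fieldType) (n m : nat) (P : 'I_m -> 'I_n -> F).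
Implicit Types (p q : {mpoly F[n]}).
Hypothesis injP : forall i j, P i =1 P j -> i = j.

(** Membership in the associated graded ideal of the vanishing ideal of the points
    [P j]: every homogeneous component, restricted to the points, coincides with
    a polynomial of smaller degree. *)
Definition in_gr p : Prop := forall d, exists2 q, (msize q <= d)%N &
  forall j, (pihomog mdeg d p).@[P j] = q.@[P j].

Lemma in_gr_subspace : subspace in_gr.
Proof.
split=> [d|a p q gp gq d].
  by exists 0; rewrite ?msize0 // => j; rewrite pihomog0.
have [p' szp p'E] := gp d; have [q' szq q'E] := gq d.
exists (a *: p' + q') => [|j]; last by rewrite pihomog_linear !mevalD !mevalZ p'E q'E.
rewrite (leq_trans (msizeD_le _ _)) // geq_max szq (leq_trans _ szp) //.
exact: msizeZ_le.
Qed.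

Lemma in_gr_mulX i p : in_gr p -> in_gr ('X_i * p).
Proof.
move=> gp [|d]; rewrite ?pihomog_mulX.
  by exists 0; rewrite ?msize0.
have [p' szp p'E] := gp d; exists ('X_i * p') => [|j]; last by rewrite !mevalM p'E.
have [->|nz_p'] := eqVneq p' 0; first by rewrite mulr0 msize0.
have nzX : 'X_i != 0 :> {mpoly F[n]} by rewrite -msize_poly_eq0 msizeX.
by rewrite msizeM // msizeX mdeg1 ltnS.
Qed.

Lemma in_gr_mul q p : in_gr p -> in_gr (q * p).
Proof.
move=> gp; apply: (mpoly_subspace (N := fun q => in_gr (q * p))) => [|mu].
  split=> [|a u v gu gv]; first by rewrite mul0r; exact: in_gr_subspace.1.
  by rewrite mulrDl -scalerAl; exact: in_gr_subspace.2.
rewrite mpolyXE_id; move: p gp.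
apply: (big_ind (fun y => forall p, in_gr p -> in_gr (y * p)))
  => [p gp|u v gu gv p gp|i _ p gp].
- by rewrite mul1r.
- by rewrite -mulrA; apply/gu/gv.
elim: (mu i) => [|e IHe]; first by rewrite mul1r.
by rewrite exprS -mulrA; apply: in_gr_mulX.
Qed.

Lemma evaluation_onto j : exists p, forall i, p.@[P i] = (i == j)%:R.
Proof.
have /fin_all_exists [l lE] i : exists l : {mpoly F[n]},
    l.@[P j] = 1 /\ (i != j -> l.@[P i] = 0).
  have [_|ne_ij] := eqVneq i j; first by exists 1; rewrite meval1.
  have [e ne_e] : exists e, P i e != P j e.
    apply/existsP; apply: contra_neqT ne_ij; rewrite negb_exists => /forallP eqP_ij.
    by apply: injP => e; apply/eqP; have := eqP_ij e; rewrite negbK.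
  exists ((P j e - P i e)^-1 *: ('X_e - (P i e)%:MP)).
  rewrite !mevalZ !mevalB !mevalXU !mevalC subrr mulr0; split=> //.
  by rewrite mulVf // subr_eq0 eq_sym.
exists (\prod_(i | i != j) l i) => i; rewrite rmorph_prod /=.
have [->|ne_ij] := eqVneq i j; first by rewrite big1 // => h _; case: (lE h).
by rewrite (bigD1 i) //= (lE i).2 // mul0r.
Qed.

Definition spanning (B : seq 'X_{1..n}) : Prop :=
  forall N, subspace N -> (forall p, in_gr p -> N p) ->
    (forall b, b \in B -> N 'X_[b]) -> forall p, N p.

(** Induction on the degree: modulo the span of [B] the top component of [p] lies
    in the associated graded ideal, so on the points it can be replaced by a
    polynomial of smaller degree. *)
Lemma spanning_evaluation B p : spanning B ->
  exists a : 'I_(size B) -> F,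
    forall j, p.@[P j] = \sum_i a i * 'X_[nth 0%MM B i].@[P j].
Proof.
move=> spanB; pose V p := exists a : 'I_(size B) -> F,
    forall j, p.@[P j] = \sum_i a i * 'X_[nth 0%MM B i].@[P j].
have linV : subspace V.
  split=> [|a u v [fu Vu] [fv Vv]].
    by exists (fun=> 0) => j; rewrite meval0 big1 // => i _; rewrite mul0r.
  exists (fun i => a * fu i + fv i) => j.
  rewrite mevalD mevalZ Vu Vv mulr_sumr -big_split /=; apply: eq_bigr => i _.
  by rewrite mulrDl mulrA.
rewrite -/(V p); have [D leD] := ubnP (msize p); elim: D p leD => // D IHD p.
rewrite ltnS => leD; rewrite (pihomog_partitionE leD).
apply: subspace_sum => // -[d lt_dD] _ /=.
apply: (spanB (fun q => V (pihomog mdeg d q))) => [|q gq|b Bb].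
- split=> [|a u v Vu Vv]; first by rewrite pihomog0; case: linV.
  by rewrite pihomog_linear; apply: linV.2.
- have [q' szq' q'E] := gq d; have [|a aE] := IHD q'; first exact: leq_ltn_trans lt_dD.
  by exists a => j; rewrite q'E.
rewrite pihomogX; case: ifP => _; last by case: linV.
have lt_b : (index b B < size B)%N by rewrite index_mem.
exists (fun i => (i == Ordinal lt_b)%:R) => j.
rewrite (bigD1 (Ordinal lt_b)) //= eqxx mul1r nth_index // big1 ?addr0 // => i ne_i.
by rewrite (negbTE ne_i) mul0r.
Qed.

(** Every function on the points is the restriction of a polynomial, so the
    restrictions of the monomials of [B] span a space of dimension [m]. *)
Lemma leq_spanning B : spanning B -> (m <= size B)%N.
Proof.
move=> spanB; pose M := \matrix_(i < size B, j < m) 'X_[nth 0%MM B i].@[P j].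
suff /eqP <- : row_full M by exact: rank_leq_row.
have /fin_all_exists [p pE] := evaluation_onto.
have /fin_all_exists [a aE] := fun j => spanning_evaluation (p j) spanB.
apply/row_fullP; exists (\matrix_(j, i) a j i); apply/matrixP=> j i; rewrite !mxE.
rewrite eq_sym -(pE j i) aE; apply: eq_bigr => h _; by rewrite !mxE.
Qed.

Lemma spanning_uniq B : spanning B -> size B = m -> uniq B.
Proof.
move=> spanB szB; rewrite -[uniq B]negbK -ltn_size_undup szB -leqNgt.
by apply: leq_spanning => N linN grN BN; apply: spanB => // b Bb; apply: BN;
  rewrite mem_undup.
Qed.

(** A linear relation modulo the associated graded ideal would allow one monomial
    to be removed from [B], leaving a spanning family with fewer elements than
    there are points. *)
Lemma spanning_free B : spanning B -> size B = m ->
  forall a : 'X_{1..n} -> F, in_gr (\sum_(b <- B) a b *: 'X_[b]) ->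
  {in B, forall b, a b = 0}.
Proof.
move=> spanB szB a ga b Bb; have uniqB := spanning_uniq spanB szB.
apply/eqP/negPn/negP => nz_a.
suff /leq_spanning : spanning (rem b B).
  by rewrite size_rem // szB leqNgt prednK ?leqnn // -szB; case: (B) Bb.
move=> N linN grN BN; apply: (spanB N) => // b' Bb'.
have [->|ne_b] := eqVneq b' b; last by apply: BN; rewrite mem_rem_uniq // inE ne_b.
have := grN _ ga; rewrite (bigD1_seq b) //= -big_filter -rem_filter //.
set rest := \sum_(h <- _) _ => Nsum.
have Nrest : N rest.
  rewrite /rest big_seq; apply: subspace_sum => // e Be.
  by apply: subspaceZ => //; apply: BN.
have := subspaceZ linN (a b)^-1 (subspaceB linN Nsum Nrest).
by rewrite addrK scalerA mulVf // scale1r.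
Qed.

End OrbitHarmonics.

(** * Leading forms of polynomials vanishing on words *)

Section PowerSymmetric.
Variables (F : fieldType) (n r : nat).

Lemma e_powE d : e_pow F r n d =
  \sum_(h : {set 'I_n} | #|h| == d) \prod_(i in h) 'X_i ^+ r.
Proof.
rewrite /e_pow /mesym raddf_sum /=; apply: eq_bigr => h _.
rewrite rmorph_prod; apply: eq_bigr => i _ /=.
by rewrite comp_mpolyXU -tnth_nth tnth_mktuple.
Qed.

Lemma e_pow_homog d : e_pow F r n d \is (r * d).-homog.
Proof.
rewrite e_powE; apply: rpred_sum => h /eqP cardh.
rewrite (eq_bigr (fun i => 'X_[F, U_(i) *+ r])) => [|i _]; last by rewrite mpolyXn.
rewrite mprodXE dhomogX /= mdeg_sum (eq_bigr (fun=> r)) => [|i _].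
  by rewrite sum_nat_const cardh mulnC.
by rewrite mdegMn mdeg1 mul1n.
Qed.

Lemma coef_esym_poly j : (j <= n)%N ->
  (esym_poly F r (enum 'I_n))`_j = e_pow F r n (n - j).
Proof.
move=> le_jn; rewrite /esym_poly big_enum /=.
rewrite (eq_bigr (fun i => ('X_i ^+ r)%:P + 'X)) => [|i _]; last exact: addrC.
rewrite bigA_distr coef_sum e_powE [RHS]big_mkcond /=; apply: eq_bigr => h _.
rewrite (bigID (mem h)) /=.
rewrite (eq_bigr (fun i => ('X_i ^+ r)%:P)) => [|i ->//].
rewrite [X in _ * X](eq_bigr (fun=> 'X)) => [|i /negbTE->//].
rewrite prodr_const -rmorph_prod /= coefCM coefXn.
set c := #|_|; have cardh : (#|h| + c)%N = n by rewrite cardC card_ord.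
have -> : (j == c) = (#|h| == (n - j)%N) by move: cardh le_jn; move: #|h|; lia.
by case: eqP; rewrite ?mulr1 ?mulr0.
Qed.

End PowerSymmetric.

Lemma homog_msize (F : fieldType) (n d : nat) (p : {mpoly F[n]}) :
  p \is d.-homog -> (msize p <= d.+1)%N.
Proof.
move=> /dhomogP hp; rewrite msizeE; apply/bigmax_leqP_seq => m /hp /= -> _ //.
Qed.

Lemma msize_subspace (F : fieldType) (n d : nat) :
  subspace (fun p : {mpoly F[n]} => (msize p <= d)%N).
Proof.
split=> [|a p q szp szq]; first by rewrite msize0.
by rewrite (leq_trans (msizeD_le _ _)) // geq_max szq (leq_trans (msizeZ_le _ _)).
Qed.

Section Generators.
Variables (F : fieldType) (n m : nat) (P : 'I_m -> 'I_n -> F).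

Lemma in_gr_homog d p q : p \is d.-homog -> (msize q <= d)%N ->
  (forall j, p.@[P j] = q.@[P j]) -> in_gr P p.
Proof.
move=> hp szq pq e; have [<-|ne_de] := eqVneq d e.
  by exists q => // j; rewrite pihomog_dE.
by exists 0; rewrite ?msize0 // => j; rewrite (pihomog_ne0 ne_de).
Qed.

(** The coordinate [x_i] is a root of [\prod_(a <- X) (T - a)], whose leading term
    is [T ^ (size X)]. *)
Lemma in_gr_power (X : seq F) i : (forall j, P j i \in X) -> in_gr P ('X_i ^+ size X).
Proof.
move=> PX; pose Q := \prod_(a <- X) ('X - a%:P).
have szQ : size Q = (size X).+1 by rewrite size_prod_XsubC.
have monQ : Q`_(size X) = 1.
  have := monic_prod_XsubC X xpredT id; rewrite -/Q monicE lead_coefE szQ.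
  by move/eqP.
pose q := \sum_(t < size X) (- Q`_t) *: ('X_i ^+ t : {mpoly F[n]}).
apply: (in_gr_homog (d := size X) (q := q)) => [||j].
- by rewrite mpolyXn dhomogX /= mdegMn mdeg1 mul1n.
- apply: (subspace_sum (msize_subspace F n _)) => t _.
  rewrite (leq_trans (msizeZ_le _ _)) // mpolyXn msizeX mdegMn mdeg1 mul1n.
  exact: ltn_ord.
have : root Q (P j i) by rewrite root_prod_XsubC.
rewrite /root horner_coef szQ big_ord_recr /= monQ mul1r addrC addr_eq0 => /eqP.
rewrite rmorphXn /= mevalXU => ->; rewrite rmorph_sum /= -sumrN.
by apply: eq_bigr => t _; rewrite mevalZ rmorphXn /= mevalXU mulNr.
Qed.

(** At a point whose coordinates have all of [A] among their [r]-th powers, the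
    polynomial [E = \prod_i (T + x_i ^ r)] is divisible by
    [D = \prod_(a <- A) (T + a)].  The coefficient of [T ^ j], [j < size A], in the
    remainder of [E] modulo [D] is [E_j] plus a linear combination, with constant
    coefficients, of the [E_i] with [i >= size A]; these have smaller degree
    than [E_j], which is thus the leading form of a polynomial that vanishes at
    all such points. *)
Lemma in_gr_esym_poly (r : nat) (A : seq F) j : (0 < r)%N -> uniq A ->
    (size A <= n)%N -> (forall h a, a \in A -> exists i, P h i ^+ r = a) ->
  (j < size A)%N -> in_gr P (esym_poly F r (enum 'I_n))`_j.
Proof.
move=> r_gt0 uniqA leAn PA lt_jA; set k := size A in leAn lt_jA.
set R := esym_poly F r _.
pose D := \prod_(a <- map -%R A) ('X - a%:P).
have szD : size D = k.+1 by rewrite size_prod_XsubC size_map.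
pose e i := ('X^i %% D)`_j.
have lt_jn : (j < n)%N by apply: leq_trans leAn.
apply: (in_gr_homog (d := (r * (n - j))%N)
  (q := \sum_(i < n.+1 | k <= i) (- e i) *: R`_i)%N) => [||h].
- by rewrite coef_esym_poly ?e_pow_homog // ltnW.
- apply: (subspace_sum (msize_subspace F n _)) => i le_ki.
  have le_in : (i <= n)%N by rewrite -ltnS.
  rewrite (leq_trans (msizeZ_le _ _)) // coef_esym_poly //.
  rewrite (leq_trans (homog_msize (e_pow_homog _ _ _ _))) //.
  rewrite ltn_mul2l r_gt0; lia.
pose E := map_poly (meval (P h)) R.
have EE : E = \prod_(i <- enum 'I_n) ('X - (- P h i ^+ r)%:P).
  rewrite /E /R rmorph_prod; apply: eq_bigr => i _.
  rewrite rmorphD /= map_polyX map_polyC /= rmorphXn /= mevalXU.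
  by rewrite polyCN opprK.
have szE : (size E <= n.+1)%N by rewrite EE size_prod_XsubC size_enum_ord.
have /eqP : E %% D == 0.
  apply: uniq_roots_dvdp; last first.
    by rewrite uniq_rootsE map_inj_uniq //; apply: oppr_inj.
  apply/allP => _ /mapP [a Aa ->]; have [i Pi] := PA h a Aa.
  rewrite EE -(big_map (fun i => - P h i ^+ r) xpredT (fun a => 'X - a%:P)).
  rewrite root_prod_XsubC; apply/mapP; exists i; rewrite ?mem_enum //.
  by rewrite Pi.
have {1}-> : E = \sum_(i < n.+1) E`_i *: 'X^i.
  rewrite -poly_def; apply/polyP => i; rewrite coef_poly; case: ltnP => // le_ni.
  by rewrite nth_default // (leq_trans szE).
rewrite (big_morph (fun p => p %% D) (modpD D) (mod0p D)).
move=> /(congr1 (fun p : {poly F} => p`_j)) /=.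
rewrite coef0 coef_sum (bigID (fun i : 'I_n.+1 => (k <= i)%N)) /=.
rewrite [X in _ + X](bigD1 (Ordinal (ltnW lt_jn : (j < n.+1)%N))) /=; last first.
  by rewrite -ltnNge.
rewrite [X in _ + (_ + X)]big1 => [|i /andP [lt_ik ne_ij]]; last first.
  rewrite modpZl coefZ modp_small ?size_polyXn ?szD ?ltnS ?ltnNge // coefXn.
  by rewrite eq_sym -val_eqE in ne_ij; rewrite (negbTE ne_ij) mulr0.
rewrite addr0 modpZl coefZ modp_small ?size_polyXn ?szD // coefXn eqxx mulr1.
move=> /eqP; rewrite addrC addr_eq0 coef_map /= => /eqP ->.
rewrite rmorph_sum -sumrN /=; apply: eq_bigr => i _.
by rewrite modpZl coefZ mevalZ coef_map /= mulNr mulrC.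
Qed.

End Generators.

(** * The basis of standard monomials *)

Section Words.
Variables (F : fieldType) (r : nat) (X A : seq F).
Implicit Types (S y : seq F).

(** The words of length [l] over the alphabet [X] in which every element of [S] is
    the [r]-th power of a letter: a first letter [a] leaves the requirements other
    than [a ^+ r] to the remaining letters. *)
Fixpoint words l S : seq (seq F) :=
  if l is l'.+1 then
    [seq a :: y | a <- X, y <- words l' [seq b <- S | b != a ^+ r]]
  else if S is [::] then [:: [::]] else [::].

Lemma mem_words l S y : y \in words l S ->
  [/\ size y = l, {subset y <= X} & {subset S <= [seq a ^+ r | a <- y]}].
Proof.
elim: l S y => [|l IH] S y /=; first by case: S => //; rewrite inE => /eqP->.
move=> /allpairsPdep [a [z [Xa /IH [szz zX Sz] ->]]] /=; split.
- by rewrite szz.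
- by move=> b; rewrite inE => /predU1P [->//|]; apply: zX.
- move=> b Sb; rewrite inE; case: eqP => //= /eqP ne_ba.
  by apply: Sz; rewrite mem_filter ne_ba.
Qed.

Hypothesis uniqX : uniq X.

Lemma words_uniq l S : uniq (words l S).
Proof.
elim: l S => [|l IH] S /=; first by case: S.
apply: allpairs_uniq_dep => // u v _ _; case: u v => [a y] [b z] /= [-> ->] //.
Qed.

Hypothesis countX : forall S, uniq S -> {subset S <= A} ->
  count (fun a => a ^+ r \in S) X = (r * size S)%N.

(** Both sides satisfy the same recursion: among the letters, [r * size S] have
    their [r]-th power in [S] and remove one requirement, as the exponents
    below [r * s] do in [std_mnm]. *)
Lemma size_words n (vs : seq 'I_n) S : uniq S -> {subset S <= A} ->
  size (words (size vs) S) = size (std_mnm r (size X) vs (size S)).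
Proof.
elim: vs S => [|v vs IH] S uniqS SA /=; first by case: S {uniqS SA}.
rewrite size_allpairs_dep size_cat !size_allpairs !size_iota.
pose g s := size (std_mnm r (size X) vs s).
rewrite (eq_map (g := fun a => if a ^+ r \in S then g (size S).-1 else g (size S))).
  have /esym := countX uniqS SA.
  have : (count (fun a => a ^+ r \in S) X + count (fun a => a ^+ r \notin S) X
    = size X)%N by rewrite -(count_predC (fun a => a ^+ r \in S) X).
  have sum_g (x y : nat) : sumn [seq if a ^+ r \in S then x else y | a <- X]
    = (count (fun a => a ^+ r \in S) X * x + count (fun a => a ^+ r \notin S) X * y)%N.
    by elim: (X) => //= a X' ->; case: ifP => _ /=; lia.
  by rewrite sum_g -/(g _) -/(g _) => <- ->; rewrite addKn.
move=> a; rewrite IH ?filter_uniq //; last first.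
  by move=> b; rewrite mem_filter => /andP [_ /SA].
rewrite -/(g _); case: ifP => [Sa|/negbT Sa].
  by rewrite -rem_filter // size_rem.
rewrite (_ : [seq _ <- _ | _] = S) //; apply/all_filterP/allP => b Sb.
by apply: contraNneq Sa => <-.
Qed.

End Words.

Section QuotientMap.
Variables (F : fieldType) (n : nat) (gens : seq {mpoly F[n]}).

Lemma mquot_pi_scale a p : mquot_pi gens (a *: p) = a *: mquot_pi gens p.
Proof. by rewrite -[RHS]/(mquot_scale a _) mquot_scaleE. Qed.

Lemma mquot_pi0 : mquot_pi gens 0 = 0.
Proof. by rewrite -(scale0r (0 : {mpoly F[n]})) mquot_pi_scale scale0r. Qed.

Lemma mquot_pi_sum (I : Type) (s : seq I) (f : I -> {mpoly F[n]}) :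
  mquot_pi gens (\sum_(i <- s) f i) = \sum_(i <- s) mquot_pi gens (f i).
Proof. exact: (big_morph _ (mquot_piD gens) mquot_pi0). Qed.

Lemma mquot_pi_eq0 p : (mquot_pi gens p = 0) <-> p \in ideal_gen gens.
Proof. by rewrite -mquot_pi0 mquot_piP subr0. Qed.

End QuotientMap.

Section Quotient.
Variables (F : fieldType) (n r k : nat) (X A : seq F).
Hypotheses (r_gt0 : (0 < r)%N) (le_kn : (k <= n)%N).
Hypotheses (uniqX : uniq X) (uniqA : uniq A) (szA : size A = k).
Hypothesis countX : forall S, uniq S -> {subset S <= A} ->
  count (fun a => a ^+ r \in S) X = (r * size S)%N.

Let c := size X.
Let gens : seq {mpoly F[n]} :=
  [seq 'X_i ^+ c | i : 'I_n] ++ [seq e_pow F r n (n - j) | j <- iota 0 k].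
Let B := std_mnm r c (enum 'I_n) k.
Let W := words r X n A.
Let P (j : 'I_(size W)) (i : 'I_n) : F := (nth [::] W j)`_i.

Let PW (j : 'I_(size W)) : nth [::] W j \in W. Proof. exact: mem_nth. Qed.

Let size_P (j : 'I_(size W)) : size (nth [::] W j) = n.
Proof. by have [] := mem_words (PW j). Qed.

Let injP i j : P i =1 P j -> i = j.
Proof.
move=> Pij; apply/val_inj/eqP.
rewrite -(nth_uniq [::] _ _ (words_uniq r uniqX n A)) ?ltn_ord //.
apply/eqP/(@eq_from_nth _ 0); first by rewrite !size_P.
by move=> h; rewrite size_P => lt_h; exact: (Pij (Ordinal lt_h)).
Qed.

Let PX i j : P j i \in X.
Proof.
by have [sz sub _] := mem_words (PW j); apply: sub; rewrite mem_nth // sz.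
Qed.

Let PA h a : a \in A -> exists i, P h i ^+ r = a.
Proof.
have [sz _ sub] := mem_words (PW h) => Aa; have /mapP [b Wb ->] := sub _ Aa.
have lt_b : (index b (nth [::] W h) < n)%N by rewrite -[X in (_ < X)%N](size_P h) index_mem.
by exists (Ordinal lt_b); rewrite /P nth_index.
Qed.

Let le_c : (r * k <= c)%N.
Proof. by rewrite -szA -(countX uniqA) // count_size. Qed.

Let size_B : size B = size W.
Proof.
by rewrite /B -szA -(size_words uniqX countX) // size_enum_ord.
Qed.

Lemma gens_sub_in_gr p : p \in gens -> in_gr P p.
Proof.
rewrite mem_cat => /orP [/mapP [i _ ->]|/mapP [j]]; first exact: in_gr_power.
rewrite mem_iota /= add0n => lt_jk ->.
rewrite -coef_esym_poly ?(leq_trans (ltnW lt_jk)) //.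
by apply: in_gr_esym_poly PA _; rewrite ?szA.
Qed.

Lemma ideal_sub_in_gr p : p \in ideal_gen gens -> in_gr P p.
Proof.
move=> /asboolP [f ->]; apply: (subspace_sum (in_gr_subspace P)) => i _.
by apply: in_gr_mul; apply: gens_sub_in_gr; apply: mem_nth.
Qed.

Lemma mem_gens p : p \in gens -> p \in ideal_gen gens.
Proof.
move=> gp; have lt_p : (index p gens < size gens)%N by rewrite index_mem.
apply/asboolP; exists (fun i => (i == Ordinal lt_p)%:R).
rewrite (bigD1 (Ordinal lt_p)) //= eqxx mul1r nth_index // big1 ?addr0 // => i ne_i.
by rewrite (negbTE ne_i) mul0r.
Qed.

(** Stated for an arbitrary subspace [N], as it serves twice: for the associated
    graded ideal in [spanning_B], and, with [N] depending on a degree [d], for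
    the degree [d] part of the quotient in [has_dim_mquot]. *)
Lemma ideal_spanning (N : {mpoly F[n]} -> Prop) : subspace N ->
    (forall mu g, g \in gens -> N ('X_[mu] * g)) ->
  (forall b, b \in B -> N 'X_[b]) -> forall p, N p.
Proof.
move=> linN Ng NB p; apply: mpoly_subspace => // mu.
suff C1 : core (enum 'I_n) N 1.
  by rewrite -[X in N X]mulr1; apply: C1 => i; rewrite mem_enum.
apply: (straightening (r := r) (c := c) (s := k)) => // [i _|j lt_jk|b Bb].
- move=> nu _; rewrite mul1r; apply: Ng; rewrite mem_cat; apply/orP; left.
  by apply/mapP; exists i; rewrite ?mem_enum.
- move=> nu _; rewrite mul1r coef_esym_poly; last first.
    by apply: leq_trans le_kn; apply: ltnW.
  apply: Ng; rewrite mem_cat; apply/orP; right.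
  by apply/mapP; exists j; rewrite ?mem_iota.
- by rewrite mul1r; apply: NB.
Qed.

Lemma spanning_B : spanning P B.
Proof.
move=> N linN grN NB p; apply: ideal_spanning => // mu g /gens_sub_in_gr gg.
by apply/grN/in_gr_mul.
Qed.

Lemma gens_homog g : g \in gens -> exists e, g \is e.-homog.
Proof.
rewrite mem_cat => /orP [/mapP [i _ ->]|/mapP [j _ ->]].
  by exists c; rewrite mpolyXn dhomogX /= mdegMn mdeg1 mul1n.
by exists (r * (n - j))%N; apply: e_pow_homog.
Qed.

(** The standard monomials span by straightening; they are independent because
    the ideal is contained in the associated graded ideal of a set with as many
    points as there are standard monomials. *)
Lemma has_dim_mquot d :
  has_dim (@mquot_deg F n gens d) (count (fun b => mdeg b == d) B).
Proof.
rewrite -size_filter; set Bd := [seq b <- B | _].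
have deg_Bd i : (i < size Bd)%N -> mdeg (nth 0%MM Bd i) = d.
  by move=> /(mem_nth 0%MM); rewrite mem_filter => /andP [/eqP].
exists (fun i => mquot_pi gens 'X_[nth 0%MM Bd i]); split=> [i|a|v].
- by exists 'X_[nth 0%MM Bd i] => //=; rewrite dhomogX /= deg_Bd.
- rewrite (eq_bigr (fun i => mquot_pi gens (a i *: 'X_[nth 0%MM Bd i]))); last first.
    by move=> i _; rewrite mquot_pi_scale.
  rewrite -mquot_pi_sum mquot_pi_eq0 => /ideal_sub_in_gr.
  have uniqBd : uniq Bd.
    by rewrite filter_uniq //; exact: (spanning_uniq injP spanning_B size_B).
  (* the coefficient of a standard monomial of another degree is 0 *)
  pose a' b := if insub (index b Bd) is Some i then a i else 0.
  have -> : \sum_i a i *: 'X_[nth 0%MM Bd i] = \sum_(b <- B) a' b *: 'X_[b].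
    rewrite [RHS](bigID (fun b => mdeg b == d)) /= [X in _ + X]big1 ?addr0.
      rewrite -[RHS]big_filter -/Bd [RHS](big_nth 0%MM) big_mkord; apply: eq_bigr => i _.
      by rewrite /a' index_uniq // valK.
    move=> b deg_b; rewrite /a' insubF ?scale0r // index_mem mem_filter.
    by rewrite (negbTE deg_b).
  move=> /(spanning_free injP spanning_B size_B) a'0 i.
  have : nth 0%MM Bd i \in B by apply: (mem_subseq (filter_subseq _ _)); exact: mem_nth.
  by move/a'0; rewrite /a' index_uniq // valK.
move=> [p /= hp <-].
pose V q := exists a : 'I_(size Bd) -> F,
  mquot_pi gens q = \sum_i a i *: mquot_pi gens 'X_[nth 0%MM Bd i].
have linV : subspace V.
  split=> [|x u w [fu Vu] [fw Vw]].
    exists (fun=> 0).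
    by rewrite big1 ?(mquot_pi_eq0 _ _).2 ?rpred0 // => i _; rewrite scale0r.
  exists (fun i => x * fu i + fw i).
  rewrite mquot_piD mquot_pi_scale Vu Vw scaler_sumr -big_split /=.
  by apply: eq_bigr => i _; rewrite scalerDl scalerA.
suff : V (pihomog mdeg d p) by rewrite pihomog_dE.
apply: (ideal_spanning (N := fun q => V (pihomog mdeg d q))).
- split=> [|x u w Vu Vw]; first by rewrite pihomog0; apply: linV.1.
  by rewrite pihomog_linear; apply: linV.2.
- move=> mu g gg; have [e he] := gens_homog gg.
  have hX : 'X_[mu] * g \is (mdeg mu + e).-homog by rewrite dhomogM // dhomogX.
  have [<-|ne_d] := eqVneq (mdeg mu + e)%N d.
    rewrite pihomog_dE //; exists (fun=> 0).
    rewrite big1 ?(mquot_pi_eq0 _ _).2 ?ideal_genM ?mem_gens // => i _; exact: scale0r.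
  by rewrite (pihomog_ne0 ne_d hX); apply: linV.1.
move=> b Bb; rewrite pihomogX /=; case: ifP => [deg_b|_]; last exact: linV.1.
have Bdb : b \in Bd by rewrite mem_filter deg_b.
have lt_b : (index b Bd < size Bd)%N by rewrite index_mem.
exists (fun i => (i == Ordinal lt_b)%:R).
rewrite (bigD1 (Ordinal lt_b)) //= eqxx scale1r nth_index // big1 ?addr0 // => i ne_i.
by rewrite (negbTE ne_i) scale0r.
Qed.

End Quotient.

(** * The two alphabets over an algebraically closed field *)

Section Letters.
Variables (C : numClosedFieldType) (r : nat).
Hypothesis r_gt0 : (0 < r)%N.

Lemma exists_unity_roots :
  exists U : seq C, [/\ uniq U, size U = r & forall a, a \in U -> a ^+ r = 1].
Proof.
have [U] := closed_field_poly_normal ('X^r - 1 : {poly C}).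
have -> : lead_coef ('X^r - 1 : {poly C}) = 1 by rewrite lead_coefXnsubC.
rewrite scale1r => defU; exists U; split=> [||a Ua].
- rewrite -separable_prod_XsubC -defU separable_Xn_sub_1 //.
  by rewrite pnatr_eq0 -lt0n.
- by apply: succn_inj; rewrite -(size_prod_XsubC _ id) -defU size_XnsubC.
have : root ('X^r - 1) a by rewrite defU root_prod_XsubC.
by rewrite /root !hornerE subr_eq0 => /eqP.
Qed.

(** The letters are the [r]-th roots of the elements of [A]. *)
Lemma exists_letters (A : seq C) : uniq A -> 0 \notin A ->
  exists X : seq C, [/\ uniq X, size X = (r * size A)%N, 0 \notin X &
    forall S, uniq S -> {subset S <= A} ->
      count (fun a => a ^+ r \in S) X = (r * size S)%N].
Proof.
have [U [uniqU szU U1]] := exists_unity_roots.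
suff : uniq A -> 0 \notin A -> exists X : seq C,
    [/\ uniq X, size X = (r * size A)%N, forall a, a \in X -> a ^+ r \in A &
    forall S : seq C, count (fun a => a ^+ r \in S) X = (r * count (mem S) A)%N].
  move=> H uniqA A0; have [X [uniqX szX XA cX]] := H uniqA A0; exists X; split=> //.
    by apply: contra A0 => /XA; rewrite expr0n -[r == 0%N]negbK -lt0n r_gt0.
  move=> S uniqS SA; rewrite cX -size_filter; congr (_ * _)%N.
  apply/perm_size/uniq_perm; rewrite ?filter_uniq // => b; rewrite mem_filter /=.
  by apply: andb_idr => /SA.
elim: A => [|b A IH] /=; first by exists [::]; rewrite muln0; split=> // S; rewrite muln0.
rewrite inE negb_or => /andP [Ab uniqA] /andP [nz_b A0].
have [X [uniqX szX XA cX]] := IH uniqA A0.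
have nz_root : r.-root b != 0 by rewrite rootC_eq0 // eq_sym.
pose Xb := [seq r.-root b * a | a <- U].
have XbE a : a \in Xb -> a ^+ r = b.
  by move=> /mapP [u Uu ->]; rewrite exprMn rootCK // U1 // mulr1.
exists (Xb ++ X); split=> [||a|S].
- rewrite cat_uniq uniqX map_inj_uniq ?uniqU /=; last exact: mulfI.
  rewrite andbT; apply/hasPn => a /XA Xa; apply: contraNN Ab => /XbE <- //.
- by rewrite size_cat size_map szU szX mulnS.
- by rewrite mem_cat => /orP [/XbE ->|/XA Aa]; rewrite inE ?eqxx // Aa orbT.
rewrite count_cat cX mulnDr; congr (_ + _)%N.
rewrite (@eq_in_count _ _ (fun=> b \in S)) => [|a /XbE -> //].
case: (b \in S); first by rewrite count_predT size_map szU muln1.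
by rewrite count_pred0 muln0.
Qed.

Lemma exists_nonzero_seq k :
  exists A : seq C, [/\ uniq A, 0 \notin A & size A = k].
Proof.
exists [seq j.+1%:R | j <- iota 0 k]; split; last by rewrite size_map size_iota.
  rewrite map_inj_uniq ?iota_uniq // => i j /eqP.
  by rewrite eqr_nat eqSS => /eqP.
by apply/mapP => -[j _ /esym /eqP]; rewrite pnatr_eq0.
Qed.

End Letters.

Definition std_hilb r n c s : {poly int} :=
  \sum_(b <- std_mnm r c (enum 'I_n) s) 'X^(mdeg b).

Section Hilb.
Variables (C : numClosedFieldType) (n r k : nat).
Hypotheses (r_gt0 : (0 < r)%N) (le_kn : (k <= n)%N).

Lemma coef_std_hilb c s d : (std_hilb r n c s)`_d
  = (count (fun b => mdeg b == d) (std_mnm r c (enum 'I_n) s))%:Z.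
Proof.
rewrite /std_hilb coef_sum; elim: (std_mnm _ _ _ _) => [|b B IH] /=.
  by rewrite big_nil.
by rewrite big_cons IH coefXn PoszD eq_sym; case: eqP.
Qed.

Lemma Hilb_Snk : Hilb_is (Snk_deg C r n k) (std_hilb r n (k * r) k).
Proof.
have [A [uniqA A0 szA]] := exists_nonzero_seq C k.
have [X [uniqX szX X0 cX]] := exists_letters r_gt0 uniqA A0.
move=> d; have := has_dim_mquot r_gt0 le_kn uniqX uniqA szA cX d.
rewrite szX szA mulnC => dimW; eexists; first exact: dimW.
by rewrite coef_std_hilb.
Qed.

(** The alphabet is enlarged by the letter 0, which accounts for the exponent
    [k * r + 1] instead of [k * r]; its [r]-th power meets no requirement. *)
Lemma Hilb_Rnk : Hilb_is (Rnk_deg C r n k) (std_hilb r n (k * r + 1) k).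
Proof.
have [A [uniqA A0 szA]] := exists_nonzero_seq C k.
have [X [uniqX szX X0 cX]] := exists_letters r_gt0 uniqA A0.
have uniqX' : uniq (0 :: X) by rewrite /= X0.
have cX' S : uniq S -> {subset S <= A} ->
    count (fun a => a ^+ r \in S) (0 :: X) = (r * size S)%N.
  move=> uniqS SA /=; rewrite cX // expr0n -[r == 0%N]negbK -lt0n r_gt0 /=.
  by have /negbTE -> : 0 \notin S by apply: contra A0; apply: SA.
move=> d; have := has_dim_mquot r_gt0 le_kn uniqX' uniqA szA cX' d.
rewrite /= szX szA mulnC -addn1 => dimW; eexists; first exact: dimW.
by rewrite coef_std_hilb.
Qed.

End Hilb.

(** * q-integers *)

Lemma q_int0 : q_int 0 = 0. Proof. exact: big_ord0. Qed.

Lemma q_intD a b : q_int (a + b) = q_int a + 'X^a * q_int b.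
Proof.
rewrite /q_int big_split_ord mulr_sumr /=; congr (_ + _).
by apply: eq_bigr => i _; rewrite exprD.
Qed.

Lemma q_int1 : q_int 1 = 1. Proof. by rewrite /q_int big_ord1. Qed.

Lemma q_intS m : q_int m.+1 = q_int m + 'X^m.
Proof. by rewrite -addn1 q_intD q_int1 mulr1. Qed.

Lemma q_intSl m : q_int m.+1 = 1 + 'X * q_int m.
Proof. by rewrite -add1n q_intD q_int1 expr1. Qed.

Section QPow.
Variable r : nat.

Lemma q_powM f g : q_pow r (f * g) = q_pow r f * q_pow r g.
Proof. exact: comp_polyM. Qed.

Lemma q_powD f g : q_pow r (f + g) = q_pow r f + q_pow r g.
Proof. exact: comp_polyD. Qed.

Lemma q_powXn i : q_pow r 'X^i = 'X^(r * i).
Proof. by rewrite /q_pow comp_Xn_poly exprM. Qed.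

Lemma q_int_mul m : q_int (r * m) = q_int r * q_pow r (q_int m).
Proof.
elim: m => [|m IH]; first by rewrite muln0 q_int0 /q_pow comp_poly0 mulr0.
by rewrite mulnS addnC q_intD IH q_intS q_powD q_powXn mulrDr [_ * q_int r]mulrC.
Qed.

End QPow.

(** * The degree generating function of standard monomials *)

Fixpoint word_hilb r c (m s : nat) : {poly int} :=
  if m is m'.+1 then
    q_int (r * s) * word_hilb r c m' s.-1
      + 'X^(r * s) * q_int (c - r * s) * word_hilb r c m' s
  else (s == 0%N)%:R.

Lemma sum_iota_q_int a m : \sum_(t <- iota a m) 'X^t = 'X^a * q_int m.
Proof.
elim: m a => [|m IH] a; first by rewrite big_nil q_int0 mulr0.
by rewrite /= big_cons IH q_intSl mulrDr mulr1 exprS mulrCA mulrA.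
Qed.

Lemma std_mnm_hilb n r c (vs : seq 'I_n) s :
  \sum_(b <- std_mnm r c vs s) 'X^(mdeg b) = word_hilb r c (size vs) s.
Proof.
elim: vs s => [|v vs IH] s /=.
  by case: s => [|s]; rewrite ?big_nil ?big_seq1 ?mdeg0.
have block (T : seq nat) B :
    \sum_(b <- [seq (U_(v) *+ t + b)%MM | t <- T, b <- B]) 'X^(mdeg b)
    = (\sum_(t <- T) 'X^t) * \sum_(b <- B) 'X^(mdeg b) :> {poly int}.
  rewrite big_allpairs_dep mulr_suml; apply: eq_bigr => t _; rewrite mulr_sumr.
  by apply: eq_bigr => b _; rewrite mdegD mdegMn mdeg1 mul1n exprD.
by rewrite big_cat /= !block !IH !sum_iota_q_int mul1r.
Qed.

Lemma std_hilbE n r c s : std_hilb r n c s = word_hilb r c n s.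
Proof. by rewrite /std_hilb std_mnm_hilb size_enum_ord. Qed.

Lemma word_hilb_q_pow r k m s : (s <= k)%N ->
  word_hilb r (k * r) m s = q_int r ^+ m * q_pow r (word_hilb 1 k m s).
Proof.
elim: m s => [|m IH] s le_sk /=; first by rewrite mul1r /q_pow rmorph_nat.
rewrite !IH ?(leq_trans (leq_pred s)) // !mul1n [(k * r)%N]mulnC -mulnBr !q_int_mul.
by rewrite q_powD !q_powM q_powXn exprS; ring.
Qed.

Lemma word_hilb_small k m s : (m < s)%N -> word_hilb 1 k m s = 0.
Proof.
elim: m s => [|m IH] s lt_ms /=; first by case: s lt_ms.
by rewrite !IH ?mulr0 ?addr0 //; lia.
Qed.

Lemma word_hilb_diag k m : word_hilb 1 k m m = q_fact m.
Proof.
elim: m => [|m IH] /=; first by rewrite /q_fact big_ord0.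
rewrite (@word_hilb_small _ m m.+1) // mulr0 addr0 mul1n [in X in X = _]IH.
by rewrite /q_fact big_ord_recr mulrC.
Qed.

(** Evaluated at [q = 1] this says that, among the words over [k + 1] letters that
    use [t] prescribed letters, those that use one further given letter and those
    that avoid it add up.  The word interpretation is replaced by an induction
    on [m] that uses the identity for [t] and [t - 1]. *)
Lemma word_hilb_drop_letter k m t : (t <= k)%N -> (t <= m)%N ->
  word_hilb 1 k.+1 m t = word_hilb 1 k.+1 m t.+1 + 'X^(m - t) * word_hilb 1 k m t.
Proof.
move=> + le_tm; elim: m t le_tm => [|m IH] t le_tm le_tk.
  by case: t le_tm le_tk => //= _ _; rewrite add0r mulr1.
(* the only new boundary case is t = m + 1, where both sides count permutations *)
have [lt_mt|{}le_tm] := ltnP m t.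
  have -> : t = m.+1 by lia.
  by rewrite !word_hilb_diag subnn mul1r word_hilb_small ?add0r.
have IHt : 'X^(m - t) * word_hilb 1 k m t
    = word_hilb 1 k.+1 m t - word_hilb 1 k.+1 m t.+1 by rewrite (IH t) // addrC addKr.
have IHt1 : q_int t * ('X^(m.+1 - t) * word_hilb 1 k m t.-1)
    = q_int t * (word_hilb 1 k.+1 m t.-1 - word_hilb 1 k.+1 m t).
  case: t le_tm le_tk {IHt} => [|t] le_tm le_tk; first by rewrite q_int0 !mul0r.
  by rewrite (IH t) 1?ltnW //= subSS addrC addKr.
have eX : 'X^(m.+1 - t) * 'X^t = 'X^t * 'X * 'X^(m - t) :> {poly int}.
  by rewrite -!exprD -exprSr -exprD; congr ('X^_); lia.
rewrite /= !mul1n subSS subSn // q_intSl q_intS.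
transitivity ((q_int t + 'X^t) * word_hilb 1 k.+1 m t
    + 'X^(t.+1) * q_int (k - t) * word_hilb 1 k.+1 m t.+1
    + (q_int t * ('X^(m.+1 - t) * word_hilb 1 k m t.-1)
       + ('X^(m.+1 - t) * 'X^t) * q_int (k - t) * word_hilb 1 k m t)); last by ring.
rewrite IHt1 eX exprSr.
transitivity (q_int t * (word_hilb 1 k.+1 m t.-1 - word_hilb 1 k.+1 m t)
    + (q_int t + 'X^t) * word_hilb 1 k.+1 m t
    + 'X^t * 'X * q_int (k - t) * (word_hilb 1 k.+1 m t.+1
         + 'X^(m - t) * word_hilb 1 k m t)); last by ring.
by rewrite IHt; ring.
Qed.

(** * Reversal of polynomials *)

(** Reversal with respect to a bound [N] on the degree; unlike [rev_q] it is
    linear, which makes it possible to reverse a recursion term by term. *)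
Definition rev_upto N (f : {poly int}) : {poly int} := \sum_(i < N.+1) f`_i *: 'X^(N - i).

Lemma coef_revp N f i : (rev_upto N f)`_i = if (i <= N)%N then f`_(N - i) else 0.
Proof.
rewrite /rev_upto coef_sum; case: leqP => [le_iN|lt_Ni].
  have lt_s : (N - i < N.+1)%N by lia.
  rewrite (bigD1 (Ordinal lt_s)) //= coefZ coefXn subKn // eqxx mulr1.
  rewrite big1 ?addr0 // => j ne_j; rewrite coefZ coefXn.
  case: eqP => [eq_i|]; last by rewrite mulr0.
  by case/eqP: ne_j; apply: val_inj => /=; have := ltn_ord j; lia.
by rewrite big1 // => j _; rewrite coefZ coefXn; case: eqP => [|_]; [lia | rewrite mulr0].
Qed.

Lemma rev_upto_linear N a f g : rev_upto N (a *: f + g) = a *: rev_upto N f + rev_upto N g.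
Proof.
apply/polyP => i; rewrite !(coefD, coefZ, coef_revp).
by case: ifP; rewrite ?coefD ?coefZ ?mulr0 ?addr0.
Qed.

Lemma rev_uptoD N f g : rev_upto N (f + g) = rev_upto N f + rev_upto N g.
Proof. by rewrite -[f]scale1r rev_upto_linear !scale1r. Qed.

Lemma rev_upto0 N : rev_upto N 0 = 0.
Proof. by apply/polyP => i; rewrite coef_revp !coef0; case: ifP. Qed.

Lemma rev_uptoZ N a f : rev_upto N (a *: f) = a *: rev_upto N f.
Proof. by rewrite -[X in rev_upto N X]addr0 rev_upto_linear rev_upto0 addr0. Qed.

Lemma rev_upto_sum N I (s : seq I) (f : I -> {poly int}) :
  rev_upto N (\sum_(i <- s) f i) = \sum_(i <- s) rev_upto N (f i).
Proof. exact: (big_morph _ (rev_uptoD N) (rev_upto0 N)). Qed.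

Lemma rev_uptoXn N i : (i <= N)%N -> rev_upto N 'X^i = 'X^(N - i).
Proof.
move=> le_iN; apply/polyP => j; rewrite coef_revp !coefXn; case: leqP => ltN.
  by have -> : (N - j == i)%N = (j == N - i)%N by lia.
by case: eqP => //; lia.
Qed.

Lemma poly_expand N (f : {poly int}) :
  (size f <= N.+1)%N -> f = \sum_(i < N.+1) f`_i *: 'X^i.
Proof.
move=> szf; rewrite -poly_def; apply/polyP => i; rewrite coef_poly; case: ltnP => // le_Ni.
by rewrite nth_default // (leq_trans szf).
Qed.

Lemma rev_uptoM N M (f g : {poly int}) : (size f <= N.+1)%N -> (size g <= M.+1)%N ->
  rev_upto (N + M) (f * g) = rev_upto N f * rev_upto M g.
Proof.
move=> szf szg; rewrite {1}(poly_expand szf) {1}(poly_expand szg).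
rewrite big_distrlr rev_upto_sum big_distrlr /=; apply: eq_bigr => i _.
rewrite rev_upto_sum; apply: eq_bigr => j _.
rewrite -!(scalerAl, scalerAr) !rev_uptoZ -exprD rev_uptoXn; last first.
  by have := ltn_ord i; have := ltn_ord j; lia.
rewrite -exprD; congr (_ *: (_ *: 'X^_)).
by have := ltn_ord i; have := ltn_ord j; lia.
Qed.

Lemma rev_q0 : rev_q 0 = 0.
Proof. by rewrite /rev_q polyseq0. Qed.

Lemma rev_qE N (f : {poly int}) : (size f <= N.+1)%N -> f`_N != 0 -> rev_q f = rev_upto N f.
Proof.
move=> szf nz_fN; have {szf} szf : size f = N.+1.
  apply/eqP; rewrite eqn_leq szf ltnNge /=; apply: contra nz_fN => szf'.
  by rewrite nth_default.
apply/polyP => i; rewrite coef_Poly coef_revp; case: leqP => [le_iN|lt_Ni].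
  by rewrite nth_rev szf ?subSS.
by rewrite nth_default // size_rev szf.
Qed.

Lemma rev_q_size f : f != 0 -> rev_q f = rev_upto (size f).-1 f.
Proof.
move=> nz_f; apply: rev_qE; first by rewrite leqSpred.
by rewrite -lead_coefE lead_coef_eq0.
Qed.

Lemma rev_qM f g : rev_q (f * g) = rev_q f * rev_q g.
Proof.
have [->|nz_f] := eqVneq f 0; first by rewrite !(mul0r, rev_q0).
have [->|nz_g] := eqVneq g 0; first by rewrite !(mulr0, rev_q0).
rewrite !rev_q_size ?mulf_neq0 // -rev_uptoM ?leqSpred // size_mul //.
have : (0 < size f)%N by rewrite size_poly_gt0.
have : (0 < size g)%N by rewrite size_poly_gt0.
by case: (size f) => // a; case: (size g) => // b _ _; rewrite addSn addnS.
Qed.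

Lemma rev_q_q_pow r f : (0 < r)%N -> rev_q (q_pow r f) = q_pow r (rev_q f).
Proof.
move=> r_gt0; have [->|nz_f] := eqVneq f 0.
  by rewrite /q_pow rev_q0 comp_poly0 rev_q0.
have szf : (0 < size f)%N by rewrite size_poly_gt0.
have nz_q : q_pow r f != 0 by rewrite /q_pow comp_poly_eq0 // size_polyXn ltnS.
rewrite !rev_q_size // (_ : (size (q_pow r f)).-1 = (r * (size f).-1)%N); last first.
  by rewrite /q_pow size_comp_poly size_polyXn mulnC.
move: (size f).-1 (leqSpred (size f)) => N leN.
rewrite /rev_upto {1}(poly_expand leN) -/(rev_upto _ _) /q_pow !raddf_sum /= rev_upto_sum.
apply: eq_bigr => i _; rewrite !comp_polyZ rev_uptoZ -!/(q_pow _ _) !q_powXn rev_uptoXn.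
  by rewrite mulnBr.
by rewrite leq_mul2l -ltnS ltn_ord orbT.
Qed.

Lemma size_q_int m : (size (q_int m) <= m)%N.
Proof.
elim: m => [|m IH]; first by rewrite q_int0 size_poly0.
rewrite q_intS (leq_trans (size_polyD _ _)) // size_polyXn geq_max leqnn andbT.
exact: leqW.
Qed.

Lemma coef_q_int m i : (q_int m)`_i = (i < m)%:R.
Proof.
elim: m => [|m IH]; first by rewrite q_int0 coef0.
by rewrite q_intS coefD coefXn IH ltnS; case: (ltngtP i m); rewrite ?addr0 ?add0r.
Qed.

Lemma rev_upto_q_int m : rev_upto m (q_int m.+1) = q_int m.+1.
Proof.
apply/polyP => i; rewrite coef_revp !coef_q_int !ltnS; case: leqP => // _.
by rewrite leq_subr.
Qed.

Lemma rev_q_q_int m : rev_q (q_int m) = q_int m.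
Proof.
case: m => [|m]; first by rewrite q_int0 rev_q0.
rewrite (rev_qE (N := m)) ?rev_upto_q_int ?size_q_int // coef_q_int ltnSn.
exact: oner_neq0.
Qed.

Lemma rev_q1 : rev_q 1 = 1. Proof. by rewrite -q_int1 rev_q_q_int. Qed.

Lemma rev_q_prod I (s : seq I) (f : I -> {poly int}) :
  (forall i, rev_q (f i) = f i) -> rev_q (\prod_(i <- s) f i) = \prod_(i <- s) f i.
Proof.
by move=> pal; rewrite (big_morph _ rev_qM rev_q1); apply: eq_bigr => i _.
Qed.

(** The factors [[r]_q] and [[k]!_(q^r)] are palindromic. *)
Lemma rev_q_hilb r k m f : (0 < r)%N ->
  rev_q (q_int r ^+ m * q_pow r (q_fact k) * q_pow r f)
    = q_int r ^+ m * q_pow r (q_fact k) * rev_q (q_pow r f).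
Proof.
move=> r_gt0; rewrite !rev_qM !rev_q_q_pow //; congr (_ * q_pow r _ * _).
  by elim: m => [|m IH]; rewrite ?expr0 ?rev_q1 // !exprS rev_qM IH rev_q_q_int.
by apply: rev_q_prod => i; apply: rev_q_q_int.
Qed.

(** * Reversed q-Stirling numbers *)

(** The recursion of [q_stir], reversed: the degree of [Stir_q(m, k)] is
    [(m - k) (k - 1)], so that of the second summand drops by [m - k]. *)
Fixpoint rev_stir (m k : nat) : {poly int} :=
  match m, k with
  | 0, 0 => 1
  | 0, _.+1 => 0
  | _.+1, 0 => 0
  | m'.+1, k'.+1 => q_int k * rev_stir m' k + 'X^(m' - k') * rev_stir m' k'
  end.

Lemma q_stir_small m k : (m < k)%N -> q_stir m k = 0.
Proof.
elim: m k => [|m IH] [|k] //= lt_mk; rewrite !IH ?mulr0 ?addr0 //; lia.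
Qed.

Lemma rev_stir_small m k : (m < k)%N -> rev_stir m k = 0.
Proof.
elim: m k => [|m IH] [|k] //= lt_mk; rewrite !IH ?mulr0 ?addr0 //; lia.
Qed.

Lemma rev_stir_diag m : rev_stir m m = 1.
Proof.
by elim: m => [|m IH] //=; rewrite rev_stir_small // IH mulr0 add0r subnn mulr1.
Qed.

Lemma coef0_rev_stir m k : (k < m)%N -> (rev_stir m k.+1)`_0 = 1.
Proof.
elim: m k => // m IH k; rewrite ltnS /= coefD !coef0M coef_q_int coefXn mul1r.
rewrite leq_eqVlt => /predU1P [->|lt_km].
  by rewrite rev_stir_small // subnn rev_stir_diag coef0 coef1 add0r mul1r.
by rewrite IH // eq_sym subn_eq0 leqNgt lt_km mul0r addr0.
Qed.

Lemma q_stir_rev m k : (k < m)%N ->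
  (size (q_stir m k.+1) <= ((m - k.+1) * k).+1)%N
  /\ rev_upto ((m - k.+1) * k) (q_stir m k.+1) = rev_stir m k.+1.
Proof.
elim: m k => // m IH k; rewrite ltnS => le_km.
rewrite [q_stir _ _]/= [rev_stir _ _]/= subSS.
have [sz1 rev1] : (size (q_int k.+1 * q_stir m k.+1)%R <= ((m - k) * k).+1)%N
    /\ rev_upto ((m - k) * k) (q_int k.+1 * q_stir m k.+1) = q_int k.+1 * rev_stir m k.+1.
  move: le_km; rewrite leq_eqVlt => /predU1P [->|lt_km].
    by rewrite q_stir_small // rev_stir_small // !mulr0 size_poly0 rev_upto0.
  have [sz rv] := IH _ lt_km.
  have -> : ((m - k) * k = k + (m - k.+1) * k)%N by rewrite -mulSn -subSn.
  split; last by rewrite rev_uptoM ?size_q_int // rv rev_upto_q_int.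
  rewrite (leq_trans (size_polyMleq _ _)) //.
  have := leq_add (size_q_int k.+1) sz; lia.
have [sz2 rev2] : (size (q_stir m k) <= ((m - k) * k).+1)%N
    /\ rev_upto ((m - k) * k) (q_stir m k) = 'X^(m - k) * rev_stir m k.
  case: k le_km {sz1 rev1} => [|k] le_km.
    case: m {IH le_km} => [|m] /=; last by rewrite size_poly0 rev_upto0 mulr0.
    rewrite size_poly1; split=> //; have := @rev_uptoXn 0 0 isT.
    by rewrite !expr0 mul1r.
  have [sz rv] := IH _ le_km.
  have -> : ((m - k.+1) * k.+1 = (m - k.+1) + (m - k.+1) * k)%N by rewrite mulnS.
  split; first by rewrite (leq_trans sz) // ltnS leq_addl.
  rewrite -[q_stir _ _]mul1r rev_uptoM ?size_poly1 // rv.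
  by have := @rev_uptoXn (m - k.+1) 0 isT; rewrite expr0 subn0 => ->.
split; last by rewrite rev_uptoD rev1 rev2.
by rewrite (leq_trans (size_polyD _ _)) // geq_max sz1.
Qed.

Lemma rev_q_stir m k : rev_q (q_stir m k) = rev_stir m k.
Proof.
case: k => [|k]; first by case: m => [|m] /=; rewrite ?rev_q1 ?rev_q0.
have [le_mk|lt_km] := leqP m k.
  by rewrite q_stir_small // rev_stir_small // rev_q0.
have [sz rv] := q_stir_rev lt_km; rewrite -rv; apply: rev_qE => //.
have := coef0_rev_stir lt_km; rewrite -rv coef_revp subn0 /= => ->.
exact: oner_neq0.
Qed.

(** The first step of the recursion of [word_hilb] leads from [k] requirements to
    [k - 1]; [word_hilb_drop_letter] expresses the result by words that use all
    letters, which is the recursion of [rev_stir]. *)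
Lemma word_hilb_rev_stir m k : word_hilb 1 k m k = q_fact k * rev_stir m k.
Proof.
elim: m k => [|m IH] [|k] /=.
- by rewrite /q_fact big_ord0 mul1r.
- by rewrite mulr0.
- by rewrite muln0 q_int0 mul0r mulr0 mul0r addr0 mulr0.
rewrite mul1n subnn q_int0 mulr0 mul0r addr0 /q_fact big_ord_recr /= -/(q_fact k).
have [le_km|lt_mk] := leqP k m.
  rewrite word_hilb_drop_letter // !IH /q_fact big_ord_recr /= -/(q_fact k).
  by ring.
rewrite word_hilb_small // (rev_stir_small lt_mk).
by rewrite (rev_stir_small (leqW lt_mk)) !mulr0 addr0 mulr0.
Qed.

Lemma word_hilb_Snk r k m : (0 < r)%N -> word_hilb r (k * r) m k
  = q_int r ^+ m * q_pow r (q_fact k) * rev_q (q_pow r (q_stir m k)).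
Proof.
move=> r_gt0; rewrite word_hilb_q_pow // word_hilb_rev_stir q_powM mulrA.
by rewrite rev_q_q_pow // rev_q_stir.
Qed.

Lemma binomial_sum_rec (A : comRingType) (y : A) (f : nat -> A) m :
  \sum_(0 <= z < m.+2) 'C(m.+1, z)%:R * y ^+ z * f (m.+1 - z)%N
  = \sum_(0 <= z < m.+1) 'C(m, z)%:R * y ^+ z * f (m - z).+1
    + y * \sum_(0 <= z < m.+1) 'C(m, z)%:R * y ^+ z * f (m - z)%N.
Proof.
rewrite big_nat_recl // bin0.
rewrite (eq_bigr (fun z => 'C(m, z.+1)%:R * y ^+ z.+1 * f (m - z)%N
   + y * ('C(m, z)%:R * y ^+ z * f (m - z)%N))); last first.
  by move=> z _; rewrite binS natrD subSS exprS; ring.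
rewrite big_split /= -mulr_sumr addrA; congr (_ + _).
transitivity (\sum_(0 <= z < m.+2) 'C(m, z)%:R * y ^+ z * f (m.+1 - z)%N).
  by rewrite [RHS]big_nat_recl // bin0.
rewrite big_nat_recr //= bin_small // !mul0r addr0; apply: eq_big_nat => z /andP [_ le_zm].
by rewrite subSn.
Qed.

(** At [q = 1], [z] is the number of occurrences of the letter 0: by Pascal's rule
    an additional letter, of weight [q ^ (k * r)], turns [word_hilb] into its
    binomial transform. *)
Lemma word_hilb_zero_letter r k m s : (s <= k)%N -> word_hilb r (k * r + 1) m s =
  \sum_(0 <= z < m.+1) 'C(m, z)%:R * 'X^(k * r * z) * word_hilb r (k * r) (m - z) s.
Proof.
elim: m s => [|m IH] s le_sk; first by rewrite big_nat1 bin0 muln0 !mul1r.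
under eq_bigr do rewrite exprM.
rewrite (binomial_sum_rec 'X^(k * r) (fun m => word_hilb r (k * r) m s)) /=.
have eXz t :
    \sum_(0 <= z < m.+1) 'C(m, z)%:R * ('X^(k * r)) ^+ z * word_hilb r (k * r) (m - z) t
    = \sum_(0 <= z < m.+1) 'C(m, z)%:R * 'X^(k * r * z) * word_hilb r (k * r) (m - z) t.
  by apply: eq_bigr => z _; rewrite -exprM.
have le_rs : (r * s <= k * r)%N by rewrite mulnC leq_mul2r le_sk orbT.
rewrite eXz -IH //; set lhs := LHS.
under eq_bigr do rewrite mulrDr mulrCA [X in _ + X]mulrCA.
rewrite big_split /= -!mulr_sumr !eXz -!IH ?(leq_trans (leq_pred s)) // -addrA -mulrDl.
rewrite /lhs -[in LHS]addnBAC // q_intD q_int1 mulr1 mulrDr -exprD subnKC //.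
Qed.

(** * Hilbert series *)

Theorem corollary4p11 (R : realType) (r n k : nat)
    (hr : (2 <= r)%N) (hn : (1 <= n)%N) (hk : (k <= n)%N) :
  [/\ Hilb_is (Rnk_deg R[i] r n k)
        (\sum_(0 <= z < n.+1) ('C(n, z))%:R * 'X^(k * r * z) *
           rev_q (q_int r ^+ (n - z) * q_pow r (q_fact k)
                  * q_pow r (q_stir (n - z) k))),
      \sum_(0 <= z < n.+1) ('C(n, z))%:R * 'X^(k * r * z) *
           rev_q (q_int r ^+ (n - z) * q_pow r (q_fact k)
                  * q_pow r (q_stir (n - z) k))
      = \sum_(0 <= z < n.+1) ('C(n, z))%:R * 'X^(k * r * z) *
           (q_int r ^+ (n - z) * q_pow r (q_fact k)
            * rev_q (q_pow r (q_stir (n - z) k))),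
      Hilb_is (Snk_deg R[i] r n k)
        (rev_q (q_int r ^+ n * q_pow r (q_fact k) * q_pow r (q_stir n k)))
    & rev_q (q_int r ^+ n * q_pow r (q_fact k) * q_pow r (q_stir n k))
      = q_int r ^+ n * q_pow r (q_fact k) * rev_q (q_pow r (q_stir n k))].
Proof.
have r_gt0 : (0 < r)%N by apply: ltnW.
have rev_sum : \sum_(0 <= z < n.+1) ('C(n, z))%:R * 'X^(k * r * z) *
      rev_q (q_int r ^+ (n - z) * q_pow r (q_fact k) * q_pow r (q_stir (n - z) k))
    = \sum_(0 <= z < n.+1) ('C(n, z))%:R * 'X^(k * r * z) *
      (q_int r ^+ (n - z) * q_pow r (q_fact k) * rev_q (q_pow r (q_stir (n - z) k))).
  by apply: eq_bigr => z _; rewrite rev_q_hilb.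
split=> //; last exact: rev_q_hilb.
  rewrite rev_sum; have := Hilb_Rnk R[i] r_gt0 hk.
  rewrite std_hilbE word_hilb_zero_letter //.
  by under eq_bigr do rewrite word_hilb_Snk //.
rewrite rev_q_hilb //; have := Hilb_Snk R[i] r_gt0 hk.
by rewrite std_hilbE word_hilb_Snk.
Qed.
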